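(* Let $S>0$, $q\in(0,1)$, and let $\varphi$ be an Orlicz-type function as described in the context, with constants $C_\varphi,C_{\varphi,q},L$ and $D_\varphi=\varphi(C_\varphi)$, $D_{\varphi,q}=\varphi(C_{\varphi,q}^q)$. Let $X=(X(t))_{t\in[0,S]}$ be a real process with càdlàg paths such that for some constant $0<C<\infty$ $$\mathbf{E}\,\varphi\left(\frac{|X(s)-X(t)|}{C|s-t|^q}\right)\le 1\qquad\text{for all } s,t\in[0,S],\ s\neq t.$$ Then there exist constants $K_1,K_2<\infty$ depending only on $\varphi,q$ (and on $C$, $L$), such that for every $c>0$ there exist random variables $Z_1,Z_2\ge 0$ with $\mathbf{E}Z_1\le 1$, $\mathbf{E}Z_2\le 1$ and $$TV^c(X,S)\le c^{\frac{q-1}{q}}S\left[K_1\,\varphi^{-1}(Z_1+D_{\varphi})+K_2\left[\varphi^{-1}(Z_2+D_{\varphi,q})\right]^{\frac1q}\right].$$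
   Context: For a càdlàg $f:[a,b]\to\mathbb R$ and $c>0$, the truncated variation is $TV^c(f,[a,b])=\sup_n\sup_{a\le t_0<t_1<\dots<t_n\le b}\sum_{i=1}^n\max\{|f(t_i)-f(t_{i-1})|-c,0\}$, and $TV^c(f,S):=TV^c(f,[0,S])$. The function $\varphi:[0,\infty)\to[0,\infty)$ is strictly increasing with $\varphi(0)=0$, $\varphi(1)=1$; there is $C_\varphi\ge0$ such that $\varphi$ is convex on $[C_\varphi,\infty)$; there is $C_{\varphi,q}\ge 0$ such that $x\mapsto\varphi(x^q)$ is convex on $[C_{\varphi,q},\infty)$; and there is $L<\infty$ with $\varphi^{-1}(xy)\le L(\varphi^{-1}(x)+\varphi^{-1}(y))$ for all $x,y\ge0$. *)

(* Defs.v *)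
From HB Require Import structures.
From mathcomp Require Import all_boot all_order all_algebra.
From mathcomp Require Import all_classical all_reals all_analysis.
Set Implicit Arguments. Unset Strict Implicit. Unset Printing Implicit Defensive.
Import Order.TTheory GRing.Theory Num.Theory.
Import numFieldNormedType.Exports.
Local Open Scope classical_set_scope.
Local Open Scope ring_scope.

Definition TVc {R : realType} (f : R -> R) (a b c : R) : \bar R :=
  ereal_sup [set v : \bar R | exists (n : nat) (t : nat -> R),
    [/\ (0 < n)%N, a <= t 0%N,
        (forall i, (i < n)%N -> t i < t i.+1), t n <= b &
        v = (\sum_(i < n) Num.max (`|f (t i.+1) - f (t i)| - c) 0)%:E]].

(* Inverse of phi on [0,oo): phi^{-1}(y) = sup {x >= 0 | phi x <= y}
   (coincides with the usual inverse whenever phi is a bijection of [0,oo)). *)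
Definition phi_inv {R : realType} (phi : R -> R) (y : R) : R :=
  sup [set x : R | 0 <= x /\ phi x <= y].

Definition convex_from {R : realType} (f : R -> R) (a : R) : Prop :=
  forall x y l : R, a <= x -> a <= y -> 0 <= l -> l <= 1 ->
    f (l * x + (1 - l) * y) <= l * f x + (1 - l) * f y.

Definition cadlag_on {R : realType} (f : R -> R) (S : R) : Prop :=
  (forall t, 0 <= t -> t < S -> f x @[x --> t^'+] --> f t) /\
  (forall t, 0 < t -> t <= S -> cvg (f x @[x --> t^'-])).

(* Main.v *)
(* Take K1 = 0. Cut [0, S] into N blocks of length at most c^(1/q), with N <= S / c^(1/q) + 1.
   On a block let Z be the sum over dyadic levels j of 2^(-2j-1) times the sum of the 2^j
   values of phi at the normalised increments of X, so E Z <= 1. Every normalised increment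
   of level j is at most phi_inv (2^(2j+1) Z) <= L (phi_inv (2^(2j+1)) + phi_inv Z), and the
   first term grows subexponentially in j; chaining gives a modulus of continuity
   A h^(q/2) + B (phi_inv Z) h^q. Since (x - 1)_+ <= x^p for p >= 1, the truncated variation
   of the block is at most its length times c^(1-1/q) K (1 + (phi_inv Z)^(1/q)). Truncated
   variation is subadditive over blocks up to c per cut, and Jensen's inequality for
   x |-> phi (x^q) averages the N blocks. Right continuity reduces everything to countably
   many grid partitions, which gives measurability. *)

Require Import Defs.
From HB Require Import structures.
From mathcomp Require Import all_boot all_order all_algebra.
From mathcomp Require Import all_classical all_reals all_analysis.
From mathcomp Require Import measurable_realfun ring lra zify.
Set Implicit Arguments.
Unset Strict Implicit.
Unset Printing Implicit Defensive.
Import Order.TTheory GRing.Theory Num.Theory.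
Import numFieldNormedType.Exports.
Local Open Scope classical_set_scope.
Local Open Scope ring_scope.

(** * Truncated variation bounds *)

(** A bound on all finite sums, so that no supremum has to be known to be finite. An arbitrary order
    lets the same lemmas serve real intervals and integer grids. Chains may repeat points: for
    [c >= 0] a repeated point contributes 0. *)
Definition TV_le {d : Order.disp_t} {T : orderType d} {R : realType}
    (f : T -> R) (a b : T) (c V : R) : Prop :=
  forall (n : nat) (t : nat -> T), (a <= t 0%N)%O ->
    (forall i, (i < n)%N -> (t i <= t i.+1)%O) -> (t n <= b)%O ->
    \sum_(i < n) Num.max (`|f (t i.+1) - f (t i)| - c) 0 <= V.

Lemma trunc_abs_addr_le (R : realType) (x y c : R) : 0 <= c ->
  Num.max (`|x + y| - c) 0 <=
  Num.max (`|x| - c) 0 + Num.max (`|y| - c) 0 + c.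
Proof.
move=> c0; have := ler_normD x y.
by case: (lerP (`|x + y| - c) 0); case: (lerP (`|x| - c) 0);
  case: (lerP (`|y| - c) 0); lra.
Qed.

Section TruncatedVariation.
Context {d : Order.disp_t} {T : orderType d} {R : realType}.
Implicit Types (f : T -> R) (a b : T) (t : nat -> T).

Lemma chain_le (n : nat) t :
  (forall i, (i < n)%N -> (t i <= t i.+1)%O) ->
  forall i j, (i <= j)%N -> (j <= n)%N -> (t i <= t j)%O.
Proof.
move=> tS i j; elim: j => [|j IHj]; first by rewrite leqn0 => /eqP ->.
rewrite leq_eqVlt => /orP[/eqP -> //|ij jn].
by apply: le_trans (tS j jn); apply: IHj => //; exact: ltnW.
Qed.

(** A monotone chain enters an upward closed set at most once, so at most one term is nonzero. *)
Lemma sum_entrance_le (P : pred T) (v : R) (n : nat) t : 0 <= v ->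
  (forall x y, (x <= y)%O -> P x -> P y) ->
  (forall i, (i < n)%N -> (t i <= t i.+1)%O) ->
  \sum_(i < n) (if ~~ P (t i) && P (t i.+1) then v else 0)
    <= if P (t n) then v else 0.
Proof.
move=> v0 Pup; elim: n => [|n IHn] tS.
  by rewrite big_ord0; case: ifP.
rewrite big_ord_recr /=.
have /IHn IH : forall i, (i < n)%N -> (t i <= t i.+1)%O.
  by move=> i /ltnW; exact: tS.
have := Pup _ _ (tS n (ltnSn n)).
move: IH; case: (P (t n)) => /= IH PnS; last first.
  by case: (P (t n.+1)); lra.
by rewrite PnS //; lra.
Qed.

(** Clip the chain at [b] with [min] and with [max] to get a chain on each side. Only an increment
    that straddles [b] is really split, which costs [c], and by [sum_entrance_le] this happens at
    most once. *)
Lemma TV_le_cat f a b e (c V1 V2 : R) : 0 <= c -> (a <= b)%O -> (b <= e)%O ->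
  TV_le f a b c V1 -> TV_le f b e c V2 -> TV_le f a e c (V1 + V2 + c).
Proof.
move=> c0 ab be TV1 TV2 n t at0 tS tn.
have h1 : \sum_(i < n) Num.max
    (`|f (Order.min (t i.+1) b) - f (Order.min (t i) b)| - c) 0 <= V1.
  apply: (TV1 n (fun i => Order.min (t i) b)) => //=.
  - by rewrite le_min at0.
  - by move=> i /tS h; rewrite le_min !ge_min h lexx orbT.
  - by rewrite ge_min lexx orbT.
have h2 : \sum_(i < n) Num.max
    (`|f (Order.max (t i.+1) b) - f (Order.max (t i) b)| - c) 0 <= V2.
  apply: (TV2 n (fun i => Order.max (t i) b)) => //=.
  - by rewrite le_max lexx orbT.
  - by move=> i /tS h; rewrite ge_max !le_max h lexx orbT.
  - by rewrite ge_max tn.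
have h3 := @sum_entrance_le (fun x => (b < x)%O) c n t c0 _ tS.
have {}h3 : \sum_(i < n) (if ~~ (b < t i)%O && (b < t i.+1)%O then c else 0) <= c.
  apply: le_trans (h3 _) _; last by case: ifP.
  by move=> x y xy bx; exact: lt_le_trans bx xy.
have maxl x y : (y <= x)%O -> @Order.max d T x y = x by exact: max_l.
have maxr x y : (x <= y)%O -> @Order.max d T x y = y by exact: max_r.
have minl x y : (x <= y)%O -> @Order.min d T x y = x by exact: min_l.
have minr x y : (y <= x)%O -> @Order.min d T x y = y by exact: min_r.
apply: le_trans (lerD (lerD h1 h2) h3).
rewrite -!big_split /=; apply: ler_sum => i _.
have tt := tS i (ltn_ord i).
have m0 (x : R) : 0 <= Num.max (`|x| - c) 0 by rewrite le_max lexx orbT.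
have [bi|ib] := ltP b (t i).
  have bS := lt_le_trans bi tt.
  rewrite ?(maxl _ _ (ltW bi)) ?(maxl _ _ (ltW bS)) /= addr0 lerDr; exact: m0.
have [bS|Sb] /= := ltP b (t i.+1).
  rewrite ?(maxr _ _ ib) ?(maxl _ _ (ltW bS)) ?(minl _ _ ib) ?(minr _ _ (ltW bS)).
  have := trunc_abs_addr_le (f b - f (t i)) (f (t i.+1) - f b) c0.
  by rewrite [f b - _ + _]addrC subrKA.
rewrite ?(maxr _ _ ib) ?(maxr _ _ Sb) ?(minl _ _ ib) ?(minl _ _ Sb) addr0 lerDl; exact: m0.
Qed.

Lemma TV_le_blocks f (p : nat -> T) (c : R) (V : nat -> R) (n : nat) : 0 <= c ->
  (forall i, (p i <= p i.+1)%O) ->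
  (forall i, (i <= n)%N -> TV_le f (p i) (p i.+1) c (V i)) ->
  TV_le f (p 0%N) (p n.+1) c (\sum_(i < n.+1) V i + n%:R * c).
Proof.
move=> c0 pS; elim: n => [|n IHn] TV.
  by rewrite big_ord1 mul0r addr0; exact: TV.
rewrite big_ord_recr /= -natr1 mulrDl mul1r.
suff -> : \sum_(i < n.+1) V i + V n.+1 + (n%:R * c + c) =
    (\sum_(i < n.+1) V i + n%:R * c) + V n.+1 + c.
  apply: (@TV_le_cat _ _ (p n.+1)) => //.
  - by apply: (@chain_le n.+1) => // i _; exact: pS.
  - by apply: IHn => i /leqW; exact: TV.
  - exact: TV.
by rewrite -!addrA; congr (_ + _); rewrite addrCA.
Qed.

(** Increments inside the half-open interval are truncated to 0. The one step that reaches [b]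
    starts within [c] of [f a], so after truncation at most [|f b - f a|] is left; a jump at [b] is
    therefore harmless. *)
Lemma TV_le_osc f a b (c : R) : 0 <= c -> (a <= b)%O ->
  (forall x y, (a <= x < b)%O -> (a <= y < b)%O -> `|f x - f y| <= c) ->
  TV_le f a b c `|f b - f a|.
Proof.
move=> c0 ab osc n t at0 tS tn.
have := @sum_entrance_le (fun x => (b <= x)%O) `|f b - f a| n t (normr_ge0 _) _ tS.
move=> h; apply: le_trans (le_trans (h _) _); last by case: ifP.
  apply: ler_sum => i _.
  have tt := tS i (ltn_ord i).
  have ai : (a <= t i)%O by apply: le_trans at0 (chain_le tS _ (ltnW (ltn_ord i))).
  have ib : (t i.+1 <= b)%O by apply: le_trans (chain_le tS _ _) tn.
  rewrite -ltNge; have [ti|ti] /= := ltP (t i) b; last first.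
    have -> : t i.+1 = t i by apply/le_anti; rewrite tt andbT (le_trans ib).
    by rewrite subrr normr0 sub0r ge_max oppr_le0 c0 lexx.
  have [tS1|tS1] := ltP (t i.+1) b.
    by rewrite ge_max lexx andbT subr_le0 osc // ?tS1 ?ti ?ai ?(le_trans ai).
  have -> : t i.+1 = b by apply/le_anti; rewrite ib.
  have o := osc a (t i).
  rewrite ge_max normr_ge0 andbT lerBlDr.
  apply: le_trans (ler_distD (f a) _ _) _; rewrite lerD2l osc // ?ai ?ti //.
  by rewrite lexx (le_lt_trans ai).
by move=> x y xy bx; exact: le_trans xy.
Qed.

End TruncatedVariation.

(** * Finiteness of the truncated variation of càdlàg functions *)

Lemma near_rightP (R : realType) (a : R) (P : R -> Prop) :
  (\forall x \near a^'+, P x) ->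
  exists2 e, 0 < e & forall x, a < x -> x < a + e -> P x.
Proof.
move=> /nbhs_ballP[e /= e0 h]; exists e => // x ax xe.
by apply: h => //=; rewrite /ball /= ltr_distlC; lra.
Qed.

Lemma near_leftP (R : realType) (a : R) (P : R -> Prop) :
  (\forall x \near a^'-, P x) ->
  exists2 e, 0 < e & forall x, a - e < x -> x < a -> P x.
Proof.
move=> /nbhs_ballP[e /= e0 h]; exists e => // x ax xe.
by apply: h => //=; rewrite /ball /= ltr_distlC; lra.
Qed.

(** Let [s] be the supremum of the times up to which the variation is bounded. The left limit at [s]
    shows that [s] itself is such a time, and right continuity goes beyond [s] unless [s = S]. Two
    values within [c / 2] of a limit differ by at most [c], so [TV_le_osc] applies. *)
Lemma cadlag_TV_le (R : realType) (f : R -> R) (S c : R) : 0 < S -> 0 < c ->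
  cadlag_on f S -> exists V, TV_le f 0 S c V.
Proof.
move=> S0 c0 [fr fl]; have c0' := ltW c0; have c2 : 0 < c / 2 by lra.
pose A := [set t : R | 0 <= t <= S /\ exists V, TV_le f 0 t c V].
have A0 : A 0.
  split; first by rewrite lexx ltW.
  by exists `|f 0 - f 0|; apply: TV_le_osc => // x y /andP[]; lra.
have Aub : has_ubound A by exists S => t [/andP[]].
have Aext a b : A a -> a <= b <= S ->
    (forall x y, a <= x < b -> a <= y < b -> `|f x - f y| <= c) -> A b.
  move=> [/andP[a0 aS] [V TV]] /andP[ab bS] osc; split.
    by rewrite bS (le_trans a0 ab).
  by exists (V + `|f b - f a| + c); apply: (TV_le_cat c0' _ ab TV) => //;
    exact: TV_le_osc.
set s := sup A.
have s0 : 0 <= s by exact: ub_le_sup.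
have sS : s <= S by apply: ge_sup; [exists 0|move=> t [/andP[]]].
have As : A s.
  have [s00|sn0] := eqVneq s 0; first by rewrite s00.
  have sp : 0 < s by rewrite lt_def sn0.
  have /cvg_ex[l /= /cvgrPdist_le/(_ _ c2)/near_leftP[e e0 he]] := fl s sp sS.
  have [t At ts] := sup_adherent e0 (conj (ex_intro _ 0 A0) Aub).
  apply: (Aext t s At) => [|x y /andP[tx xs] /andP[ty ys]].
    by rewrite sS andbT; exact: ub_le_sup.
  have := he x (lt_le_trans ts tx) xs; have := he y (lt_le_trans ts ty) ys.
  by move=> h1 h2; apply: le_trans (ler_distD l _ _) _; rewrite (distrC (f x)); lra.
have [-> //|sSn] := eqVneq S s; first by case: As.
have sS' : s < S by rewrite lt_def sSn.
have /cvgrPdist_le/(_ _ c2)/near_rightP[e e0 he] := fr s s0 sS'.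
have As' : A (Num.min (s + e / 2) S).
  apply: (Aext s) => //.
    by rewrite ge_min lexx orbT andbT le_min sS andbT; lra.
  have h x : s <= x < Num.min (s + e / 2) S -> `|f s - f x| <= c / 2.
    rewrite lt_min => /and3P[sx xe xS]; move: sx; rewrite le_eqVlt => /orP[/eqP <-|sx].
      by rewrite subrr normr0 ltW.
    by apply: he => //; lra.
  move=> x y /h hx /h hy; apply: le_trans (ler_distD (f s) _ _) _.
  by rewrite (distrC (f x)); lra.
have : Num.min (s + e / 2) S <= s by exact: ub_le_sup.
by rewrite ge_min; lra.
Qed.

(** * Dyadic chaining *)

(** Here [e] counts from the finest level: [dl e] controls steps of length [2 ^ e]. Clearing the low
    binary digits of [k] one at a time costs at most one step per level. *)
Lemma chain_dyadic_floor (R : realType) (F : nat -> R) (dl : nat -> R) (m : nat) :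
  (forall e k, (e <= m)%N -> (k.+1 * 2 ^ e <= 2 ^ m)%N ->
     `|F (k.+1 * 2 ^ e)%N - F (k * 2 ^ e)%N| <= dl e) ->
  forall e k, (e <= m)%N -> (k <= 2 ^ m)%N -> (forall i, 0 <= dl i) ->
  `|F k - F (k %/ 2 ^ e * 2 ^ e)%N| <= \sum_(i < e) dl i.
Proof.
move=> hF e k em km dl0; elim: e em => [|e IHe] em.
  by rewrite big_ord0 divn1 muln1 subrr normr0.
rewrite big_ord_recr /=; apply: le_trans (ler_distD (F (k %/ 2 ^ e * 2 ^ e)%N) _ _) _.
apply: lerD; first by apply: IHe; exact: ltnW.
(* Passing from level [e] to [e.+1] replaces [p] by twice its half, a move by one step when [p] is
   odd and no move otherwise. *)
rewrite expnSr divnMA; set p := (k %/ 2 ^ e)%N.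
have pk : (p * 2 ^ e <= 2 ^ m)%N by apply: leq_trans km; exact: leq_trunc_div.
rewrite (mulnC (2 ^ e)%N) mulnA {1}(divn_eq p 2) modn2.
case: (boolP (odd p)) => [po|pe]; last by rewrite addn0 subrr normr0.
have pp : p = (p %/ 2 * 2).+1 by rewrite {1}(divn_eq p 2) modn2 po addn1.
by rewrite addn1; apply: hF; [exact: ltnW|rewrite -pp].
Qed.

(** Round both indices down to multiples of [2 ^ e]. As they are at most [2 ^ e] apart, the rounded
    indices are equal or adjacent, and the one connecting step [dl e] is absorbed by the last term
    of the doubled sum. *)
Lemma chain_dyadic (R : realType) (F : nat -> R) (dl : nat -> R) (m : nat) :
  (forall e k, (e <= m)%N -> (k.+1 * 2 ^ e <= 2 ^ m)%N ->
     `|F (k.+1 * 2 ^ e)%N - F (k * 2 ^ e)%N| <= dl e) ->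
  forall e k l, (e <= m)%N -> (k <= l)%N -> (l <= 2 ^ m)%N ->
  (l - k <= 2 ^ e)%N -> (forall i, 0 <= dl i) ->
  `|F l - F k| <= 2 * \sum_(i < e.+1) dl i.
Proof.
move=> hF e k l em kl lm lk dl0.
have hk := chain_dyadic_floor hF em (leq_trans kl lm) dl0.
have hl := chain_dyadic_floor hF em lm dl0.
set p := (k %/ 2 ^ e)%N in hk; set p' := (l %/ 2 ^ e)%N in hl.
have hm : `|F (p' * 2 ^ e)%N - F (p * 2 ^ e)%N| <= dl e.
  have e0 : (0 < 2 ^ e)%N by rewrite expn_gt0.
  have pp' : (p <= p')%N by exact: leq_div2r.
  have p'p : (p' <= p.+1)%N.
    rewrite -ltnS ltn_divLR // mulSn.
    have := ltn_ceil k e0; rewrite -/p; lia.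
  have {pp' p'p}[->|pE] : p' = p \/ p' = p.+1 by lia.
    by rewrite subrr normr0.
  rewrite pE; apply: hF => //; rewrite -pE.
  by apply: leq_trans lm; exact: leq_trunc_div.
rewrite big_ord_recr /= mulrDr.
have := ler_distD (F (p' * 2 ^ e)%N) (F l) (F k).
have := ler_distD (F (p * 2 ^ e)%N) (F (p' * 2 ^ e)%N) (F k).
by rewrite (distrC (F (p * 2 ^ e)%N) (F k)); have := dl0 e; lra.
Qed.

Lemma TV_le_lipschitz (R : realType) (F : nat -> R) (K : nat) (c B : R) : 0 <= B ->
  (forall k l, (k < l)%N -> (l <= K)%N ->
     Num.max (`|F l - F k| - c) 0 <= B * (l - k)%:R) -> 0 <= c ->
  TV_le F 0%N K c (B * K%:R).
Proof.
move=> B0 hF c0 n t _ tS tn.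
apply: (@le_trans _ _ (B * (t n - t 0%N)%:R)); last first.
  by rewrite ler_wpM2l // ler_nat; apply: leq_trans tn; exact: leq_subr.
elim: n tS tn => [|n IHn] tS tn; first by rewrite big_ord0 subnn mulr0.
have t0n : (t 0%N <= t n)%N by exact: (chain_le tS).
have tt : (t n <= t n.+1)%N by exact: tS.
rewrite big_ord_recr /=.
have -> : (t n.+1 - t 0 = (t n - t 0) + (t n.+1 - t n))%N by lia.
rewrite natrD mulrDr; apply: lerD.
  by apply: IHn; [move=> i /ltnW; exact: tS|exact: leq_trans tt tn].
move: tt; rewrite leq_eqVlt => /orP[/eqP ->|tt]; last exact: hF.
by rewrite subrr normr0 sub0r subnn mulr0 ge_max oppr_le0 c0 lexx.
Qed.

Lemma TV_le_shift (R : realType) (F : nat -> R) (a b : nat) (c V : R) :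
  (a <= b)%N ->
  TV_le (fun k => F (a + k)%N) 0%N (b - a)%N c V -> TV_le F a b c V.
Proof.
move=> ab TV n t at0 tS tn.
have at' i : (i <= n)%N -> (a <= t i)%N.
  by move=> ile; apply: leq_trans at0 _; apply: (chain_le tS).
have := TV n (fun i => (t i - a)%N); move/(_ isT) => h.
apply: le_trans (h _ _).
- apply: ler_sum => i _; rewrite !subnKC //; apply: at' => //; exact: ltnW.
- by move=> i /tS; rewrite !leEnat; exact: leq_sub2r.
- by rewrite leEnat; apply: leq_sub2r.
Qed.

Lemma powR_gt1 (R : realType) (a x : R) : 1 < a -> 0 < x -> 1 < a `^ x.
Proof.
move=> a1 x0; have := gt0_ltr_powR x0 _ _ a1; rewrite powR1; apply.
  by rewrite nnegrE.
by rewrite nnegrE ltW // (lt_trans _ a1).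
Qed.

(** The terms grow with [i], so the coarsest level [i = e] dominates the chaining sum. *)
Lemma geometric_sum_le (R : realType) (x : R) (m e : nat) : 0 < x -> x < 1 ->
  (e <= m)%N -> \sum_(i < e.+1) x ^+ (m - i) <= (1 - x)^-1 * x ^+ (m - e).
Proof.
move=> x0 x1; have x1' : 0 < 1 - x by rewrite subr_gt0.
elim: e => [|e IHe] em.
  rewrite big_ord1 ler_peMl ?exprn_ge0 ?(ltW x0) // invf_ge1 //.
  by rewrite lerBlDr lerDl ltW.
rewrite big_ord_recr /=; apply: le_trans (lerD (IHe (ltnW em)) (lexx _)) _.
have -> : (m - e = (m - e.+1).+1)%N by lia.
rewrite exprS le_eqVlt; apply/orP; left; apply/eqP; field; lra.
Qed.

(** When [x + y > 1], twice the larger summand exceeds 1 and dominates the left side, and raising it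
    to a power at least 1 only increases it. Two exponents are allowed because the two parts of the
    modulus of continuity scale differently. *)
Lemma subr1_le_powR (R : realType) (x y p1 p2 : R) : 0 <= x -> 0 <= y ->
  1 <= p1 -> 1 <= p2 ->
  Num.max (x + y - 1) 0 <= (2 * x) `^ p1 + (2 * y) `^ p2.
Proof.
move=> x0 y0 hp1 hp2; rewrite ge_max addr_ge0 ?powR_ge0 // andbT.
have := powR_ge0 (2 * x) p1; have := powR_ge0 (2 * y) p2.
have [xy|yx] := leP x y.
  have [y1|y1] := leP 1 (2 * y); last by lra.
  by have := le1r_powR y1 hp2; lra.
have [x1|x1] := leP 1 (2 * x); last by lra.
by have := le1r_powR x1 hp1; lra.
Qed.

Lemma max_mul_subr1 (R : realType) (x c : R) : 0 <= c ->
  Num.max (c * x - c) 0 = c * Num.max (x - 1) 0.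
Proof. by move=> c0; rewrite maxr_pMr // mulr0 mulrBr mulr1. Qed.

(* Up to constants F has modulus of continuity v^q c (A h^(q/2) + M h^q), h the
   relative distance; (x + y - 1)_+ <= (2x)^(2/q) + (2y)^(1/q) turns the truncated
   increments into multiples of h. *)
Lemma TV_le_dyadic_block (R : realType) (q C A v c M : R) (m : nat) (F : nat -> R) :
  0 < q -> q < 1 -> 0 < C -> 0 <= A -> 0 <= v -> v <= 1 -> 0 < c -> 0 <= M ->
  (forall j k, (j <= m)%N -> (k < 2 ^ j)%N ->
     `|F (k.+1 * 2 ^ (m - j))%N - F (k * 2 ^ (m - j))%N| <=
     C * (v `^ q * c) *
     (A * (2 `^ (- (q / 2))) ^+ j + M * ((2 `^ (- (q / 2))) ^+ 2) ^+ j)) ->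
  TV_le F 0%N (2 ^ m)%N c (c * v *
    (2 * (4 * C * (1 - 2 `^ (- (q / 2)))^-1 * A) `^ (2 / q) +
     2 * (4 * C * (1 - 2 `^ (- (q / 2)))^-1 * M) `^ (1 / q))).
Proof.
move=> q0 q1 C0 A0 v0 v1 c0 M0 hF.
set r := 2 `^ (- (q / 2)) in hF *; set B := (1 - r)^-1.
set k1 := (_ `^ (2 / q)); set k2 := (_ `^ (1 / q)).
have r0 : 0 < r by rewrite powR_gt0.
have r1 : r < 1.
  by rewrite /r powRN invf_lt1 ?powR_gt0 // powR_gt1 // ?ltr1n //; lra.
have rr0 : 0 < r ^+ 2 by rewrite exprn_gt0.
have rr1 : r ^+ 2 < 1 by rewrite expr2; nra.
have B0 : 0 < B by rewrite invr_gt0 subr_gt0.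
have BB : (1 - r ^+ 2)^-1 <= B by rewrite lef_pV2 ?posrE; nra.
have vq0 := powR_ge0 v q.
have k10 : 0 <= k1 by exact: powR_ge0.
have k20 : 0 <= k2 by exact: powR_ge0.
(* The hypothesis numbers levels from the coarsest, chaining from the finest, hence [j = m - e]. *)
pose dl (e : nat) := C * (v `^ q * c) * (A * r ^+ (m - e) + M * (r ^+ 2) ^+ (m - e)).
have Cvc0 : 0 <= C * (v `^ q * c) by rewrite !mulr_ge0 // ltW.
have rj0 j : 0 <= r ^+ j by rewrite exprn_ge0 // ltW.
have rrj0 j : 0 <= (r ^+ 2) ^+ j by rewrite exprn_ge0 // ltW.
have dl0 i : 0 <= dl i by rewrite mulr_ge0 // addr_ge0 // mulr_ge0.
have hdl e k : (e <= m)%N -> (k.+1 * 2 ^ e <= 2 ^ m)%N ->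
    `|F (k.+1 * 2 ^ e)%N - F (k * 2 ^ e)%N| <= dl e.
  move=> em km; have := hF (m - e)%N k (leq_subr _ _).
  rewrite subKn //; apply.
  by rewrite -(@leq_pmul2r (2 ^ e)%N) ?expn_gt0 // -expnD subnK.
have hsum e : (e <= m)%N -> 2 * \sum_(i < e.+1) dl i <=
    c * (2 * C * B * A * (v `^ q) * r ^+ (m - e) +
         2 * C * B * M * (v `^ q) * (r ^+ 2) ^+ (m - e)).
  move=> em; rewrite -mulr_sumr big_split /= -!mulr_sumr.
  have h1 := geometric_sum_le r0 r1 em.
  have h2 : \sum_(i < e.+1) (r ^+ 2) ^+ (m - i) <= B * (r ^+ 2) ^+ (m - e).
    by apply: le_trans (geometric_sum_le rr0 rr1 em) _; rewrite ler_wpM2r.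
  apply: (@le_trans _ _ (2 * (C * (v `^ q * c) *
     (A * (B * r ^+ (m - e)) + M * (B * (r ^+ 2) ^+ (m - e)))))).
    rewrite ler_pM2l // ler_wpM2l // lerD // ler_wpM2l //.
  by rewrite le_eqVlt; apply/orP; left; apply/eqP; ring.
have two_m : 0 < (2 ^ m)%:R :> R by rewrite ltr0n expn_gt0.
have -> : c * v * (2 * k1 + 2 * k2) = (c * v * (2 * k1 + 2 * k2) / (2 ^ m)%:R) * (2 ^ m)%:R.
  by rewrite mulfVK // gt_eqF.
apply: TV_le_lipschitz; [| |exact: ltW].
  by rewrite divr_ge0 ?ler0n // mulr_ge0 ?addr_ge0 ?mulr_ge0 ?(ltW c0).
move=> k l kl lm.
have h0 : (0 < l - k)%N by rewrite subn_gt0.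
(* The least power of two above [l - k] is less than a factor 2 too large, so bounds in [2 ^ e]
   become bounds linear in [l - k]. *)
have [e [em he he2]] : exists e, [/\ (e <= m)%N, (l - k <= 2 ^ e)%N & (2 ^ e <= 2 * (l - k))%N].
  exists (up_log 2 (l - k)); split.
  - by apply: up_log_min => //; apply: leq_trans lm; exact: leq_subr.
  - exact: up_logP.
  - have [h1|h1] := leqP (l - k) 1.
      have /eqP -> : (l - k == 1)%N by rewrite eqn_leq h1.
      by rewrite up_log1.
    have := up_log_bounds (isT : (1 < 2)%N) h1.
    have := up_log_gt0 2 (l - k)%N; rewrite h1 => /prednK {2}<- /andP[h2 _].
    rewrite expnS leq_pmul2l //; exact: ltnW.
have hh := chain_dyadic hdl em (ltnW kl) lm he dl0.
have {}hh := le_trans hh (hsum e em).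
set X := _ * r ^+ (m - e) in hh; set Y := _ * (r ^+ 2) ^+ (m - e) in hh.
have X0 : 0 <= X by rewrite /X; do !(apply: mulr_ge0 => //); exact: ltW.
have Y0 : 0 <= Y by rewrite /Y; do !(apply: mulr_ge0 => //); exact: ltW.
apply: (@le_trans _ _ (c * Num.max (X + Y - 1) 0)).
  rewrite -(max_mul_subr1 _ (ltW c0)).
  by rewrite ge_max !le_max lexx orbT andbT lerD2r hh.
have p1 : 1 <= 2 / q by rewrite ler_pdivlMr //; lra.
have p2 : 1 <= 1 / q by rewrite ler_pdivlMr //; lra.
apply: le_trans (ler_wpM2l (ltW c0) (subr1_le_powR X0 Y0 p1 p2)) _.
(* The exponents [2 / q] and [1 / q] are chosen so that both decay rates turn into the relative
   distance [2 ^ (e - m)]. *)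
have rpow : (r ^+ (m - e)) `^ (2 / q) = ((2 ^ (m - e))%:R)^-1.
  rewrite -powR_mulrn ?ltW // /r -!powRrM.
  have -> : - (q / 2) * ((m - e)%:R * (2 / q)) = - (m - e)%:R by field; rewrite gt_eqF.
  by rewrite powRN powR_mulrn // natrX.
have rrpow : ((r ^+ 2) ^+ (m - e)) `^ (1 / q) = ((2 ^ (m - e))%:R)^-1.
  rewrite -rpow -exprM -(powR_mulrn _ (ltW r0)) -(powR_mulrn _ (ltW r0)) -!powRrM; congr (_ `^ _).
  by rewrite natrM; field; rewrite gt_eqF.
(* The left side is [v ^ 2]; this is where [v <= 1], a block no longer than [c ^ (1/q)], is used. *)
have vv : (v `^ q) `^ (2 / q) <= v.
  rewrite -powRrM; have -> : q * (2 / q) = 2%:R by field; rewrite gt_eqF.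
  by rewrite powR_mulrn // expr2; nra.
have vv' : (v `^ q) `^ (1 / q) = v.
  rewrite -powRrM; have -> : q * (1 / q) = 1 by field; rewrite gt_eqF.
  by rewrite powRr1.
set h := ((2 ^ (m - e))%:R)^-1 : R in rpow rrpow.
have h00 : 0 <= h by rewrite invr_ge0 ler0n.
have hle : h <= 2 * (l - k)%:R / (2 ^ m)%:R.
  rewrite ler_pdivlMr // /h -{2}(subnK em) expnD natrM mulrA mulVf ?mul1r.
    by rewrite -natrM ler_nat.
  by rewrite gt_eqF // ltr0n expn_gt0.
have CB0 : 0 <= 4 * C * B by do !(apply: mulr_ge0 => //); exact: ltW.
have e1 : (2 * X) `^ (2 / q) <= k1 * v * h.
  have -> : 2 * X = (4 * C * B * A) * (v `^ q) * (r ^+ (m - e)) by rewrite /X; ring.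
  have a0 : 0 <= 4 * C * B * A by rewrite mulr_ge0.
  rewrite powRM ?(mulr_ge0 a0) // powRM // rpow; apply: ler_wpM2r => //.
  by apply: ler_wpM2l.
have e2 : (2 * Y) `^ (1 / q) = k2 * v * h.
  have -> : 2 * Y = (4 * C * B * M) * (v `^ q) * ((r ^+ 2) ^+ (m - e)) by rewrite /Y; ring.
  have a0 : 0 <= 4 * C * B * M by rewrite mulr_ge0.
  by rewrite powRM ?(mulr_ge0 a0) // powRM // rrpow vv'.
rewrite e2.
apply: (@le_trans _ _ (c * ((k1 + k2) * v * h))).
  rewrite ler_pM2l //; lra.
have -> : c * v * (2 * k1 + 2 * k2) / (2 ^ m)%:R * (l - k)%:R =
   c * ((k1 + k2) * v * (2 * (l - k)%:R / (2 ^ m)%:R)) by field; rewrite gt_eqF.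
by rewrite ler_pM2l // ler_wpM2l // mulr_ge0 // addr_ge0.
Qed.

(** * Orlicz-type functions *)

Lemma expr_unbounded (R : realType) (r M : R) : 1 < r ->
  exists n1, forall n, (n1 <= n)%N -> M <= r ^+ n.
Proof.
move=> r1; have r10 : 0 < r - 1 by rewrite subr_gt0.
have bern n : n%:R * (r - 1) <= r ^+ n.
  elim: n => [|n IHn]; first by rewrite mul0r expr0.
  rewrite exprS -natr1 mulrDl mul1r.
  have : 1 <= r ^+ n by rewrite exprn_ege1 // ltW.
  by move: IHn; nra.
exists (Num.truncn (M / (r - 1))).+1 => n hn; apply: le_trans (bern n).
rewrite -ler_pdivrMr //; apply: (le_trans (ltW (truncnS_gt _))).
by rewrite ler_nat.
Qed.

Section OrliczFunction.
Context {R : realType} (phi : R -> R) (Cphi : R).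
Hypothesis phi_incr : forall x y, 0 <= x -> x < y -> phi x < phi y.
Hypothesis phi0 : phi 0 = 0.
Hypothesis Cphi0 : 0 <= Cphi.
Hypothesis phi_conv : convex_from phi Cphi.

Lemma phi_le x y : 0 <= x -> x <= y -> phi x <= phi y.
Proof.
by move=> x0; rewrite le_eqVlt => /orP[/eqP -> //|xy]; exact/ltW/phi_incr.
Qed.

Lemma phi_ge0 x : 0 <= x -> 0 <= phi x.
Proof. by move=> x0; rewrite -phi0; apply: phi_le. Qed.

(** Beyond [Cphi + 1], convexity keeps [phi] above its chord through [Cphi] and [Cphi + 1], whose
    slope is positive. The bound matters because [sup] of an unbounded set is 0, which would make
    [phi_inv] meaningless. *)
Lemma phi_sublevel_has_ubound y : has_ubound [set x : R | 0 <= x /\ phi x <= y].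
Proof.
set s := phi (Cphi + 1) - phi Cphi.
have s0 : 0 < s by rewrite subr_gt0; apply: phi_incr => //; lra.
exists (Cphi + 1 + `|y - phi Cphi| / s) => x [x0 xy].
have [xC|Cx] := leP x (Cphi + 1).
  by apply: le_trans xC _; rewrite lerDl divr_ge0 // ltW.
have u0 : 0 < x - Cphi by lra.
have := phi_conv (x := x) (y := Cphi) (l := (x - Cphi)^-1).
have -> : (x - Cphi)^-1 * x + (1 - (x - Cphi)^-1) * Cphi = Cphi + 1.
  by field; lra.
have l0 : 0 <= (x - Cphi)^-1 by rewrite invr_ge0 ltW.
have l1 : (x - Cphi)^-1 <= 1 by rewrite invf_le1 //; lra.
move=> h; have {}h : s <= (x - Cphi)^-1 * (phi x - phi Cphi).
  by have := h _ (lexx _) l0 l1; rewrite /s; lra.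
rewrite -lerBlDl; apply: (@le_trans _ _ (x - Cphi)); first lra.
rewrite ler_pdivlMr //; move: h; rewrite mulrC ler_pdivlMr // mulrC => h.
by apply: le_trans h (le_trans _ (ler_norm _)); lra.
Qed.

Lemma le_phi_inv x y : 0 <= x -> phi x <= y -> x <= phi_inv phi y.
Proof. by move=> x0 xy; apply: ub_le_sup => //; exact: phi_sublevel_has_ubound. Qed.

Lemma phi_inv_ge0 y : 0 <= y -> 0 <= phi_inv phi y.
Proof. by move=> y0; apply: le_phi_inv => //; rewrite phi0. Qed.

Lemma phi_inv_le y z : 0 <= y -> y <= z -> phi_inv phi y <= phi_inv phi z.
Proof.
move=> y0 yz; apply: ge_sup; first by exists 0; split; rewrite ?phi0.
by move=> x [x0 xy]; apply: le_phi_inv => //; exact: le_trans yz.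
Qed.

(* phi may jump below Cphi, so phi (phi_inv phi y) <= y can fail. *)
Lemma phi_half_inv_le y : 0 <= y -> phi (phi_inv phi y / 2) <= y.
Proof.
move=> y0; have := phi_inv_ge0 y0; rewrite le_eqVlt => /orP[/eqP <-|p0].
  by rewrite mul0r phi0.
have [|x [x0 xy] hx] := @sup_adherent R [set x : R | 0 <= x /\ phi x <= y]
  (phi_inv phi y / 2) (divr_gt0 p0 (ltr0Sn _ _)).
  by split; [exists 0; split; rewrite ?phi0|exact: phi_sublevel_has_ubound].
apply: le_trans xy; apply: phi_le; first by rewrite divr_ge0 // ltW.
by move: hx; rewrite -/(phi_inv phi y); lra.
Qed.

(* Taking x = y in the hypothesis, phi_inv (2^n) at most multiplies by 2L when n doubles,
   so it grows polynomially in n. *)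
Lemma phi_inv_pow2_le (L r : R) : phi 1 = 1 -> 1 < r ->
  (forall x y, 0 <= x -> 0 <= y ->
     phi_inv phi (x * y) <= L * (phi_inv phi x + phi_inv phi y)) ->
  0 <= L /\ exists2 A, 0 <= A & forall n, phi_inv phi (2 ^+ n) <= A * r ^+ n.
Proof.
move=> phi1 r1 hL.
have i1 : 1 <= phi_inv phi 1 by apply: le_phi_inv => //; rewrite phi1.
have L0 : 0 <= L.
  have := hL 1 1 ler01 ler01; rewrite mulr1 => h.
  by rewrite leNgt; apply/negP => Ln; nra.
split=> //; have [n1 hn1] := expr_unbounded (2 * L) r1.
pose h n := phi_inv phi (2 ^+ n).
have pow0 n : 0 <= 2 ^+ n :> R by rewrite exprn_ge0.
have hmono n k : (n <= k)%N -> h n <= h k.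
  by move=> nk; apply: phi_inv_le => //; apply: ler_weXn2l => //; rewrite ler1n.
have h0 n : 0 <= h n by exact: phi_inv_ge0.
(* The constant covers all small [n]. For larger [n], split the exponent into halves: the lower half
   is at least [n1], so its power of [r] absorbs the factor [2 * L]. *)
exists (h (2 * n1).+1) => // n; rewrite -/(h n).
elim/ltn_ind: n => n IHn.
have [nn1|n1n] := leqP n (2 * n1).+1.
  by apply: le_trans (hmono _ _ nn1) _; rewrite ler_peMr // exprn_ege1 // ltW.
have hn2 : (n1 <= n./2)%N by lia.
have an : (n - n./2 < n)%N by lia.
have ba : (n./2 <= n - n./2)%N by lia.
have -> : h n = phi_inv phi (2 ^+ (n - n./2) * 2 ^+ n./2).
  by rewrite -exprD subnK //; lia.
apply: le_trans (hL _ _ (pow0 _) (pow0 _)) _.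
apply: (@le_trans _ _ (2 * L * h (n - n./2)%N)).
  rewrite (mulrC 2) -mulrA ler_wpM2l // mulrC mulr_natr mulr2n lerD2l.
  exact: hmono.
rewrite -{3}(subnK (_ : n./2 <= n)%N); last by lia.
rewrite exprD mulrA mulrC; apply: ler_pM => //; last exact: hn1.
- by rewrite mulr_ge0.
- exact: IHn.
Qed.

End OrliczFunction.

(** Jensen's inequality for equal weights, by induction: the new mean is a convex combination of the
    old mean and the new point. *)
Lemma convex_from_mean (R : realType) (g : R -> R) (a : R) (x : nat -> R) (n : nat) :
  convex_from g a -> (forall i, a <= x i) ->
  g ((\sum_(i < n.+1) x i) / n.+1%:R) <= (\sum_(i < n.+1) g (x i)) / n.+1%:R.
Proof.
move=> gc xa.
have am k : a <= (\sum_(i < k.+1) x i) / k.+1%:R.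
  rewrite ler_pdivlMr // mulr_natr -[X in a *+ X]card_ord -sumr_const.
  exact: ler_sum.
elim: n => [|n IHn]; first by rewrite !big_ord1 !divr1.
pose l : R := n.+1%:R / n.+2%:R.
have n2 : n.+2%:R = n.+1%:R + 1 :> R by rewrite natr1.
have n1 : 0 < n.+1%:R :> R by [].
have l0 : 0 <= l by rewrite divr_ge0.
have l1 : l <= 1 by rewrite ler_pdivrMr // mul1r n2; lra.
have e (y z : R) : l * (y / n.+1%:R) + (1 - l) * z = (y + z) / n.+2%:R.
  by rewrite /l n2; field; lra.
rewrite !(big_ord_recr n.+1) /= -!e.
apply: le_trans (gc _ _ _ (am n) (xa _) l0 l1) _.
by rewrite lerD2r ler_wpM2l.
Qed.

(** Freezing a monotone function at its value in [a] to the left of [a] makes its convexity global,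
    so that Jensen's inequality also covers points below [a]. *)
Lemma convex_from_max (R : realType) (g : R -> R) (a : R) :
  (forall x y, a <= x -> x <= y -> g x <= g y) ->
  convex_from g a -> forall b, convex_from (fun x => g (Num.max x a)) b.
Proof.
move=> gm gc b x y l _ _ l0 l1.
have ax z : a <= Num.max z a by rewrite le_max lexx orbT.
apply: le_trans (gc _ _ _ (ax x) (ax y) l0 l1); apply: gm => //.
rewrite ge_max; apply/andP; split.
  by rewrite lerD // ler_wpM2l ?subr_ge0 // le_max lexx.
apply: (@le_trans _ _ (l * a + (1 - l) * a)); first by lra.
by rewrite lerD // ler_wpM2l ?subr_ge0 // le_max lexx orbT.
Qed.

(** * Pathwise bound on the truncated variation from dyadic increments *)

Section PathwiseBound.
Context {R : realType} (phi : R -> R) (q C L A : R).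
Hypotheses (q0 : 0 < q) (q1 : q < 1) (C0 : 0 < C) (L0 : 0 <= L) (A0 : 0 <= A).
Hypothesis phi_le_inv : forall x y, 0 <= x -> phi x <= y -> x <= phi_inv phi y.
Hypothesis inv_ge0 : forall y, 0 <= y -> 0 <= phi_inv phi y.
Hypothesis inv_mul : forall x y, 0 <= x -> 0 <= y ->
  phi_inv phi (x * y) <= L * (phi_inv phi x + phi_inv phi y).
Hypothesis inv_pow2 : forall j,
  L * phi_inv phi (2 ^+ (2 * j).+1) * (2 `^ (- (q / 2))) ^+ j <= A.

Definition orlicz_ratio (f : R -> R) (s t : R) : R :=
  `|f s - f t| / (C * `|s - t| `^ q).

Definition dyadic_pt (h : R) (b j k : nat) : R := h * (b%:R + k%:R / 2 ^+ j).

(** The half is there because [phi (phi_inv phi z / 2) <= z] survives jumps of [phi]; the maximum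
    with 1 absorbs additive constants. *)
Definition block_weight (z : R) : R := Num.max 1 ((phi_inv phi z / 2) `^ (1 / q)).

(** The summand 1 pays for the cuts between blocks, and [2 * L] makes up for the halving in
    [block_weight]. *)
Definition TV_const : R :=
  1 + 2 * (4 * C * (1 - 2 `^ (- (q / 2)))^-1 * A) `^ (2 / q) +
  2 * (4 * C * (1 - 2 `^ (- (q / 2)))^-1 * (2 * L)) `^ (1 / q).

(** With [r = 2 ^ (-q/2)], a step of length [h / 2 ^ j] carries the factor [r ^ (2j)]. In the part
    from [phi_inv (2 ^ (2j+1))] one factor [r ^ j] is spent on its growth; the part with [phi_inv z]
    keeps both. *)
Lemma dyadic_increment_le (f : R -> R) (h z : R) (b j k : nat) : 0 < h -> 0 <= z ->
  phi (orlicz_ratio f (dyadic_pt h b j k.+1) (dyadic_pt h b j k))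
    <= 2 ^+ (2 * j).+1 * z ->
  `|f (dyadic_pt h b j k.+1) - f (dyadic_pt h b j k)| <=
  C * h `^ q * (A * (2 `^ (- (q / 2))) ^+ j +
     (L * phi_inv phi z) * ((2 `^ (- (q / 2))) ^+ 2) ^+ j).
Proof.
move=> h0 z0; set r := 2 `^ (- (q / 2)); set s := dyadic_pt _ _ _ _.+1; set t := dyadic_pt _ _ _ _.
have r0 : 0 < r by rewrite powR_gt0.
have pj : 0 < 2 ^+ j :> R by rewrite exprn_gt0.
have st : `|s - t| `^ q = h `^ q * (r ^+ 2) ^+ j.
  have -> : s - t = h * (2 ^+ j)^-1.
    rewrite /s /t /dyadic_pt -natr1; field; by rewrite gt_eqF.
  rewrite ger0_norm ?mulr_ge0 ?invr_ge0 ?(ltW h0) ?(ltW pj) //.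
  rewrite powRM ?invr_ge0 ?(ltW h0) ?(ltW pj) //; congr (_ * _).
  rewrite -[2 ^+ j](powR_mulrn j (ler0n _ 2)) -powRN -exprM.
  rewrite -(powR_mulrn _ (ltW r0)) -!powRrM; congr (_ `^ _).
  by rewrite natrM; field.
have d0 : 0 < C * `|s - t| `^ q.
  by rewrite st !mulr_gt0 ?powR_gt0 // exprn_gt0 // exprn_gt0.
have x0 : 0 <= orlicz_ratio f s t by rewrite divr_ge0 // ltW.
have p0 : 0 <= 2 ^+ (2 * j).+1 :> R by rewrite exprn_ge0.
move=> /(phi_le_inv x0)/le_trans/(_ (inv_mul p0 z0)).
rewrite ler_pdivrMr // => /le_trans; apply.
rewrite st (mulrA C) mulrCA ler_wpM2l ?mulr_ge0 ?powR_ge0 ?(ltW C0) //.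
rewrite mulrDr mulrDl lerD // expr2 exprMn mulrA.
by rewrite ler_wpM2r ?exprn_ge0 ?(ltW r0) ?inv_pow2.
Qed.

Lemma block_sum_le (V : R) : 0 <= V ->
  1 + (2 * (4 * C * (1 - 2 `^ (- (q / 2)))^-1 * A) `^ (2 / q) +
     2 * (4 * C * (1 - 2 `^ (- (q / 2)))^-1 * (L * V)) `^ (1 / q))
  <= TV_const * Num.max 1 ((V / 2) `^ (1 / q)).
Proof.
move=> V0; rewrite /TV_const; set k1 := _ `^ (2 / q); set B := (1 - _)^-1.
have B0 : 0 <= B.
  rewrite invr_ge0 subr_ge0 powRN invf_le1 ?powR_gt0 //.
  by apply/ltW/powR_gt1; rewrite ?ltr1n // divr_gt0.
have -> : 4 * C * B * (L * V) = (4 * C * B * (2 * L)) * (V / 2) by field.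
have CB0 : 0 <= 4 * C * B * (2 * L).
  by do !(apply: mulr_ge0 => //); exact: ltW.
rewrite powRM ?divr_ge0 //; set k2 := _ `^ (1 / q); set y := _ `^ (1 / q).
have k10 : 0 <= k1 by exact: powR_ge0.
have k20 : 0 <= k2 by exact: powR_ge0.
have m1 : 1 <= Num.max 1 y by rewrite le_max lexx.
have my : y <= Num.max 1 y by rewrite le_max lexx orbT.
by have := ler_wpM2l k10 m1; have := ler_wpM2l k20 my; nra.
Qed.

(* The extra (N - 1) c paid for cutting [0, S] into N = n + 1 blocks is affordable because
   n <= S / c^(1/q). *)
Lemma TV_le_grid (f : R -> R) (S c : R) (z : nat -> R) (m n : nat) :
  0 < S -> 0 < c -> n = Num.truncn (S / c `^ (1 / q)) ->
  (forall b, 0 <= z b) ->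
  (forall b j k, (b <= n)%N -> (k < 2 ^ j)%N ->
     phi (orlicz_ratio f (dyadic_pt (S / n.+1%:R) b j k.+1)
                         (dyadic_pt (S / n.+1%:R) b j k)) <= 2 ^+ (2 * j).+1 * z b) ->
  TV_le (fun i => f (dyadic_pt (S / n.+1%:R) 0 m i)) 0%N (n.+1 * 2 ^ m)%N c
    (c `^ ((q - 1) / q) * S *
      (TV_const * ((\sum_(b < n.+1) block_weight (z b)) / n.+1%:R))).
Proof.
move=> S0 c0 nE z0 hz; set F := fun i : nat => _.
have c1q : 0 < c `^ (1 / q) by rewrite powR_gt0.
have n0 : 0 < n.+1%:R :> R by [].
set rho := S / c `^ (1 / q) in nE.
have rho0 : 0 < rho by rewrite divr_gt0.
have nrho : n%:R <= rho by rewrite nE truncn_le ltW.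
have rhon : rho < n.+1%:R by rewrite nE truncnS_gt.
(* Block length in units of [c ^ (1/q)]; it is at most 1 since [n + 1] exceeds [rho]. *)
pose v := rho / n.+1%:R.
have v0 : 0 <= v by rewrite divr_ge0 // ltW.
have v1 : v <= 1 by rewrite ler_pdivrMr // mul1r ltW.
have h0 : 0 < S / n.+1%:R by rewrite divr_gt0.
have hE : (S / n.+1%:R) `^ q = v `^ q * c.
  have -> : S / n.+1%:R = v * c `^ (1 / q).
    by rewrite /v /rho; field; rewrite (gt_eqF c1q); lra.
  rewrite powRM ?(ltW c1q) // -powRrM.
  have -> : 1 / q * q = 1 by field; rewrite gt_eqF.
  by rewrite powRr1 // ltW.
have p2 j : 0 < 2 ^+ j :> R by rewrite exprn_gt0.
pose V b := c * v *
    (2 * (4 * C * (1 - 2 `^ (- (q / 2)))^-1 * A) `^ (2 / q) +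
     2 * (4 * C * (1 - 2 `^ (- (q / 2)))^-1 * (L * phi_inv phi (z b))) `^ (1 / q)).
have TVb b : (b <= n)%N -> TV_le F (b * 2 ^ m)%N (b.+1 * 2 ^ m)%N c (V b).
  move=> bn; apply: TV_le_shift; first by rewrite leq_mul2r leqnSn orbT.
  rewrite mulSn addnK; apply: TV_le_dyadic_block => //.
    by rewrite mulr_ge0 // inv_ge0.
  move=> j k jm kj; have pjm : 2 ^+ m = 2 ^+ (m - j) * 2 ^+ j :> R.
    by rewrite -exprD subnK.
  have FE i : F (b * 2 ^ m + i * 2 ^ (m - j))%N = f (dyadic_pt (S / n.+1%:R) b j i).
    rewrite /F /dyadic_pt natrD !natrM !natrX; congr (f (_ * _)).
    by rewrite pjm add0r; field; rewrite !gt_eqF.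
  rewrite !FE -hE; apply: dyadic_increment_le => //; exact: hz.
have pS b : (b * 2 ^ m <= b.+1 * 2 ^ m)%N by rewrite leq_mul2r leqnSn orbT.
have := @TV_le_blocks _ _ _ F (fun b => b * 2 ^ m)%N c V n (ltW c0) pS TVb; rewrite mul0n => TV k t t0 tS tn.
apply: le_trans (TV k t t0 tS tn) _.
have -> : c `^ ((q - 1) / q) * S *
   (TV_const * ((\sum_(b < n.+1) block_weight (z b)) / n.+1%:R)) =
   \sum_(b < n.+1) c * v * (TV_const * block_weight (z b)).
  rewrite -!mulr_sumr; have -> : c `^ ((q - 1) / q) = c / c `^ (1 / q).
    have -> : (q - 1) / q = 1 - 1 / q by field; rewrite gt_eqF.
    by rewrite powRB ?(gt_eqF c0) ?implybT // powRr1 // ltW.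
  by rewrite /v /rho; field; rewrite (gt_eqF c1q); lra.
(* The cost [n * c] of the cuts is spread evenly over the blocks, since [n <= rho = (n + 1) * v]. *)
apply: (@le_trans _ _ (\sum_(b < n.+1) (V b + c * v))).
  rewrite big_split /= lerD2l sumr_const card_ord -[c * v *+ _]mulr_natr -mulrA [n%:R * c]mulrC.
  by rewrite ler_pM2l // /v divfK // gt_eqF.
apply: ler_sum => b _; rewrite /V -[X in _ + X <= _]mulr1 -mulrDr.
have cv0 : 0 <= c * v by rewrite mulr_ge0 // ltW.
rewrite (ler_wpM2l cv0) // addrC.
by apply: block_sum_le; exact: inv_ge0.
Qed.

End PathwiseBound.

(** * Reduction to grid partitions *)

Lemma TV_le_comp (R : realType) (d d' : Order.disp_t) (T : orderType d)
    (T' : orderType d') (p : T' -> T) (f : T -> R) (a b : T') (c V : R) :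
  (forall x y, (x <= y)%O -> (p x <= p y)%O) ->
  TV_le f (p a) (p b) c V -> TV_le (f \o p) a b c V.
Proof.
move=> pm TV n t at0 tS tn; apply: (TV n (p \o t)) => /=; try exact: pm.
by move=> i /tS; exact: pm.
Qed.

Section GridVariation.
Context {R : realType} (h : R) (N : nat) (c : R).
Hypotheses (h0 : 0 < h) (N0 : (0 < N)%N) (c0 : 0 < c).

Definition grid_sum (f : R -> R) (m : nat) (s : seq nat) : R :=
  \sum_(i < (size s).-1) Num.max
    (`|f (dyadic_pt h 0 m (nth 0%N s i.+1)) - f (dyadic_pt h 0 m (nth 0%N s i))| - c) 0.

Definition is_grid_partition (x : nat * seq nat) : bool :=
  sorted leq x.2 && all (fun k => k <= N * 2 ^ x.1)%N x.2.

(** Enumerates the sums over all dyadic partitions through a coding of pairs (level, list of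
    indices), so that their supremum is a countable one. Codes of no partition get the harmless
    value 0. *)
Definition grid_seq (f : R -> R) (i : nat) : R :=
  if @unpickle (nat * seq nat)%type i is Some x then
    if is_grid_partition x then grid_sum f x.1 x.2 else 0
  else 0.

Lemma dyadic_pt_le m (i k : nat) : (i <= k)%N -> dyadic_pt h 0 m i <= dyadic_pt h 0 m k.
Proof.
move=> ik; by rewrite /dyadic_pt ler_pM2l // lerD2l ler_pM2r ?ler_nat // invr_gt0 exprn_gt0.
Qed.

Lemma dyadic_pt_end m : dyadic_pt h 0 m (N * 2 ^ m) = h * N%:R.
Proof.
by rewrite /dyadic_pt add0r natrM natrX mulfK // gt_eqF // exprn_gt0.
Qed.

Lemma dyadic_pt_itv m k : (k <= N * 2 ^ m)%N -> 0 <= dyadic_pt h 0 m k <= h * N%:R.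
Proof.
move=> hk; rewrite -(dyadic_pt_end m) dyadic_pt_le // andbT.
by rewrite /dyadic_pt mulr_ge0 ?(ltW h0) // add0r divr_ge0 // exprn_ge0.
Qed.

Lemma grid_seq_le (f : R -> R) (V : R) :
  (forall m, TV_le (fun i => f (dyadic_pt h 0 m i)) 0%N (N * 2 ^ m)%N c V) ->
  forall i, grid_seq f i <= V.
Proof.
move=> TV i; have V0 : 0 <= V.
  by have := TV 0%N 0%N (fun _ => 0%N); rewrite big_ord0; apply.
rewrite /grid_seq; case: unpickle => [[m s]|//]; rewrite /is_grid_partition /grid_sum /=.
case: ifP => // /andP[ss sa]; apply: (TV m (size s).-1 (nth 0%N s)) => //.
- move=> j js; apply/(sortedP 0%N) => //; case: s js {ss sa} => //.
- by case: s {ss} sa => // x s /(all_nthP 0%N)/(_ (size s) (ltnSn _)).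
Qed.

Lemma grid_seq_le_real (f : R -> R) (V : R) :
  TV_le f 0 (h * N%:R) c V -> forall i, grid_seq f i <= V.
Proof.
move=> TV; apply: grid_seq_le => m.
apply: (@TV_le_comp _ _ _ _ _ (dyadic_pt h 0 m)) => [x y|]; first exact: dyadic_pt_le.
by rewrite dyadic_pt_end /dyadic_pt add0r mul0r mulr0.
Qed.

(** The successor of the truncation gives a grid point strictly to the right of [t], as right
    continuity requires; the cap keeps it inside the interval. *)
Definition round_up (m : nat) (t : R) : nat :=
  minn (Num.truncn (t / h * 2 ^+ m)).+1 (N * 2 ^ m).

Lemma round_up_le m (s t : R) : s <= t -> (round_up m s <= round_up m t)%N.
Proof.
move=> st; rewrite leq_min geq_minr andbT geq_min ltnS le_truncn //.
by rewrite ler_pM2r ?exprn_gt0 // ler_pM2r // invr_gt0.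
Qed.

Lemma cvg_round_up (f : R -> R) (t : R) : cadlag_on f (h * N%:R) ->
  0 <= t -> t <= h * N%:R ->
  f (dyadic_pt h 0 m (round_up m t)) @[m --> \oo] --> f t.
Proof.
move=> [fr _] t0; rewrite le_eqVlt => /orP[/eqP tS|tS].
  (* At the right endpoint the cap returns the endpoint itself at every level. *)
  rewrite [X in X @ _ --> _](_ : _ = fun=> f t); first exact: cvg_cst.
  apply/funext => m; congr f; rewrite tS /round_up -(dyadic_pt_end m).
  congr dyadic_pt; apply/minn_idPr.
  rewrite /dyadic_pt add0r [h * _]mulrC mulfK ?gt_eqF // mulfVK ?gt_eqF ?exprn_gt0 //.
  by rewrite natrK.
have t1 m : t < dyadic_pt h 0 m (round_up m t).
  have pm : 0 < 2 ^+ m :> R by rewrite exprn_gt0.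
  rewrite /round_up; case: leqP => _; last by rewrite dyadic_pt_end.
  rewrite /dyadic_pt add0r -ltr_pdivrMl // ltr_pdivlMr // [h^-1 * t]mulrC.
  exact: truncnS_gt.
have t2 m : dyadic_pt h 0 m (round_up m t) <= t + h / 2 ^+ m.
  have pm : 0 < 2 ^+ m :> R by rewrite exprn_gt0.
  apply: le_trans (dyadic_pt_le m (geq_minl _ _)) _.
  rewrite /dyadic_pt add0r -natr1 mulrDl mul1r mulrDr lerD2r.
  rewrite mulrA -ler_pdivlMr ?invr_gt0 // invrK -ler_pdivlMl // mulrA [h^-1 * t]mulrC.
  by rewrite truncn_le mulr_ge0 ?divr_ge0 ?(ltW h0) ?(ltW pm).
apply/cvgrPdist_le => e e0.
have /cvgrPdist_le/(_ _ e0)/near_rightP[d d0 hd] := fr t t0 tS.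
have [n1 hn1] := expr_unbounded (h / d + 1) (ltr1n R 2).
near=> m; apply: hd => //; apply: le_lt_trans (t2 m) _.
rewrite ltrD2l ltr_pdivrMr ?exprn_gt0 // mulrC -ltr_pdivrMr //.
apply: lt_le_trans (hn1 m _); first by rewrite ltrDl.
by near: m; exact: nbhs_infty_ge.
Unshelve. all: by end_near. Qed.

(** Round all points of a partition up at one sufficiently fine level. Rounding preserves order, and
    right continuity makes the change of the finite sum arbitrarily small. *)
Lemma TV_le_of_grid_seq (f : R -> R) (V : R) : cadlag_on f (h * N%:R) ->
  (forall i, grid_seq f i <= V) -> TV_le f 0 (h * N%:R) c V.
Proof.
move=> fc fV n t t0 tS tn; apply/ler_addgt0Pr => e e0.
pose r m i := dyadic_pt h 0 m (round_up m (t i)).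
(* Each of the [n] increments has two endpoints, so the total error stays below [e]. *)
have e'0 : 0 < e / (2 * n.+1%:R) by rewrite divr_gt0 // mulr_gt0.
have tin i : (i <= n)%N -> 0 <= t i <= h * N%:R.
  move=> ile; rewrite (le_trans t0 (chain_le tS _ _)) //=.
  exact: le_trans (chain_le tS ile _) tn.
have near_n k : (k <= n)%N -> \forall m \near \oo, forall i, (i <= k)%N ->
    `|f (t i) - f (r m i)| <= e / (2 * n.+1%:R).
  elim: k => [|k IHk] kn.
    have /andP[a b] := tin 0%N isT.
    have /cvgrPdist_le/(_ _ e'0) := cvg_round_up fc a b.
    by apply: filterS => m H i; rewrite leqn0 => /eqP ->.
  have /andP[a b] := tin _ kn.
  have /cvgrPdist_le/(_ _ e'0) := cvg_round_up fc a b.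
  apply: filterS2 (IHk (ltnW kn)) => m H1 H2 i.
  by rewrite leq_eqVlt => /orP[/eqP -> //|]; exact: H1.
have [m hm] := @filter_ex _ _ _ _ (near_n n (leqnn n)).
pose s := mkseq (fun i => round_up m (t i)) n.+1.
have sE i : (i <= n)%N -> nth 0%N s i = round_up m (t i).
  by move=> ile; rewrite nth_mkseq.
have gp : is_grid_partition (m, s).
  apply/andP; split; rewrite [(m, s).2]/=.
    apply/(sortedP 0%N) => i; rewrite size_mkseq ltnS => ile.
    by rewrite !sE ?(ltnW ile) //; apply: round_up_le; exact: tS.
  by apply/allP => k /mapP[i _ ->]; exact: geq_minr.
have := fV (pickle (m, s)); rewrite /grid_seq pickleK gp /grid_sum size_mkseq [(m, s).2]/= [n.+1.-1]/=.
move=> gV; apply: le_trans (_ : _ <= \sum_(i < n) (Num.max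
    (`|f (r m i.+1) - f (r m i)| - c) 0 + e / n.+1%:R)) _.
  apply: ler_sum => i _.
  have h1 := hm i (ltnW (ltn_ord i)); have h2 := hm i.+1 (ltn_ord i).
  have -> : e / n.+1%:R = e / (2 * n.+1%:R) + e / (2 * n.+1%:R) by field.
  have h3 := ler_distD (f (r m i.+1)) (f (t i.+1)) (f (t i)).
  have h4 := ler_distD (f (r m i)) (f (r m i.+1)) (f (t i)).
  rewrite (distrC (f (r m i))) in h4.
  rewrite ge_max; apply/andP; split.
    have : `|f (r m i.+1) - f (r m i)| - c <=
      Num.max (`|f (r m i.+1) - f (r m i)| - c) 0 by rewrite le_max lexx.
    by move: h1 h2 h3 h4; set z := e / _; lra.
  by rewrite addr_ge0 ?addr_ge0 ?(ltW e'0) // le_max lexx orbT.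
rewrite big_split /= lerD //.
  apply: le_trans gV; rewrite le_eqVlt; apply/orP; left; apply/eqP.
  by apply: eq_bigr => i _; rewrite /r !sE // ltnW.
rewrite sumr_const card_ord -[_ *+ n]mulr_natr mulrAC ler_pdivrMr // ler_pM2l //.
by rewrite ler_nat.
Unshelve. all: by end_near. Qed.

End GridVariation.

Lemma TVc_le (R : realType) (f : R -> R) (a b c V : R) :
  TV_le f a b c V -> (TVc f a b c <= V%:E)%E.
Proof.
move=> TV; apply: ge_ereal_sup => _ [n [t [_ at0 tS tn ->]]].
by rewrite lee_fin; apply: TV => // i /tS /ltW.
Qed.

(** * Expectations *)

(** Jensen's inequality for [G x = phi (max (x, Cphiq) ^ q)] bounds [G] at the mean weight. Since
    [x] is at most half that mean, convexity between the mean and 0, where [G] is [phi (Cphiq ^ q)],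
    gains a further factor 1/2, which offsets an expectation of at most 2 for [1 + z b]. *)
Lemma orlicz_mean_le (R : realType) (phi : R -> R) (q Cphi Cphiq x : R)
    (z : nat -> R) (n : nat) : 0 < q ->
  (forall x y, 0 <= x -> x < y -> phi x < phi y) ->
  phi 0 = 0 -> phi 1 = 1 -> 0 <= Cphi -> convex_from phi Cphi ->
  0 <= Cphiq -> convex_from (fun x => phi (x `^ q)) Cphiq ->
  (forall b, 0 <= z b) -> 0 <= x ->
  x <= (\sum_(b < n.+1) block_weight phi q (z b)) / n.+1%:R / 2 ->
  phi (x `^ q) - phi (Cphiq `^ q) <= (2 * n.+1%:R)^-1 * \sum_(b < n.+1) (1 + z b).
Proof.
move=> q0 incr phi0 phi1 C0 conv Cq0 convq z0 x0 xle.
pose g x := phi (x `^ q); pose G x := g (Num.max x Cphiq).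
have gm u v : 0 <= u -> u <= v -> g u <= g v.
  move=> u0 uv; apply: (phi_le incr); first exact: powR_ge0.
  by apply: ge0_ler_powR; rewrite ?nnegrE ?(ltW q0) // (le_trans u0).
have Gc : convex_from G 0.
  by apply: convex_from_max => // u v /(le_trans Cq0); exact: gm.
set Y := fun b => block_weight phi q (z b).
have Y0 b : 0 <= Y b by rewrite le_max ler01.
have GY b : G (Y b) <= phi (Cphiq `^ q) + (1 + z b).
  have gY : g (Y b) <= 1 + z b.
    rewrite /g /Y /block_weight.
    have [_|_] := leP 1 ((phi_inv phi (z b) / 2) `^ (1 / q)); last first.
      by rewrite powR1 phi1 lerDl.
    rewrite -powRrM; have -> : 1 / q * q = 1 by field; rewrite gt_eqF.
    rewrite powRr1 ?divr_ge0 ?(phi_inv_ge0 incr phi0 C0 conv) //.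
    apply: le_trans (phi_half_inv_le incr phi0 C0 conv (z0 b)) _.
    by rewrite lerDr.
  rewrite /G; have [_|_] := leP (Y b) Cphiq; first by rewrite lerDl addr_ge0.
  by apply: le_trans gY _; rewrite lerDr; apply: (phi_ge0 incr phi0); exact: powR_ge0.
have n0 : 0 < n.+1%:R :> R by [].
set a := (\sum_(b < n.+1) Y b) / n.+1%:R.
have a0 : 0 <= a by rewrite divr_ge0 // sumr_ge0.
have G0 : G 0 = phi (Cphiq `^ q) by rewrite /G max_r.
have Ga : G a <= phi (Cphiq `^ q) + (\sum_(b < n.+1) (1 + z b)) / n.+1%:R.
  apply: le_trans (convex_from_mean n Gc Y0) _.
  rewrite ler_pdivrMr // mulrDl divfK ?gt_eqF //.
  rewrite mulr_natr -[X in _ *+ X](card_ord n.+1) -sumr_const -big_split /=.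
  by apply: ler_sum => b _; exact: GY.
have Gx : g x <= G (a / 2).
  by apply: gm => //; apply: le_trans xle _; rewrite le_max lexx.
have half0 : 0 <= 2^-1 :> R by rewrite invr_ge0.
have half1 : 2^-1 <= 1 :> R by rewrite invf_le1 // ler1n.
have := Gc a 0 2^-1 a0 (lexx _) half0 half1.
rewrite mulr0 addr0 [2^-1 * a]mulrC G0.
have -> : (2 * n.+1%:R)^-1 * \sum_(b < n.+1) (1 + z b) =
    (\sum_(b < n.+1) (1 + z b)) / n.+1%:R / 2 by field; lra.
move: Gx Ga; rewrite /g; set D := phi (Cphiq `^ q); set u := phi _; set t := _ / n.+1%:R.
set G1 := G _; set G2 := G a.
by lra.
Qed.

Lemma measurable_phi_comp (R : realType) (phi : R -> R) (d : measure_display)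
    (T : measurableType d) (f : T -> R) :
  (forall x y, 0 <= x -> x <= y -> phi x <= phi y) ->
  (forall w, 0 <= f w) -> measurable_fun setT f ->
  measurable_fun setT (fun w => phi (f w)).
Proof.
move=> phim f0 mf.
(* [phi] is monotone on [[0, oo)] only; composing with [max] makes it monotone, hence measurable, on
   the whole line. *)
have -> : (fun w => phi (f w)) = (fun x => phi (Num.max x 0)) \o f.
  by apply/funext => w /=; rewrite max_l.
apply: measurableT_comp => //; apply: nondecreasing_measurable => // x y xy.
apply: phim; first by rewrite le_max lexx orbT.
by rewrite ge_max !le_max xy lexx orbT.
Qed.

Lemma integral_le_of_mean (R : realType) (d : measure_display) (T : measurableType d)
    (P : probability T R) (Z : nat -> T -> \bar R) (f : T -> R) (n : nat) :
  (forall b, measurable_fun setT (Z b)) -> (forall b w, (0 <= Z b w)%E) ->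
  (forall b, (b <= n)%N -> (\int[P]_w Z b w <= 1)%E) ->
  measurable_fun setT f -> (forall w, 0 <= f w) ->
  (forall w, ((f w)%:E <= ((2 * n.+1%:R)^-1)%:E * \sum_(b < n.+1) (1 + Z b w))%E) ->
  (\int[P]_w (f w)%:E <= 1)%E.
Proof.
move=> mZ Z0 iZ mf f0 fle.
have n0 : 0 <= (2 * n.+1%:R)^-1 :> R by rewrite invr_ge0 mulr_ge0.
have m1Z b : measurable_fun setT (fun w => (1 + Z b w)%E).
  by apply: emeasurable_funD => //; exact: measurable_cst.
have p1Z b w : (0 <= 1 + Z b w)%E by rewrite adde_ge0.
have mS : measurable_fun setT (fun w => (\sum_(b < n.+1) (1 + Z b w))%E).
  by exact: (@emeasurable_sum _ _ _ _ 'I_n.+1 _ (fun b w => (1 + Z b w)%E)).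
apply: (@le_trans _ _
  (\int[P]_w (((2 * n.+1%:R)^-1)%:E * \sum_(b < n.+1) (1 + Z b w)))%E).
  apply: ge0_le_integral => //.
  - by move=> w _; rewrite lee_fin.
  - exact/measurable_EFinP.
  - by exact: measurable_funeM.
rewrite ge0_integralZl //; last first.
  by move=> w _; rewrite sume_ge0.
rewrite (@ge0_integral_sum _ _ _ _ _ _ 'I_n.+1 (fun b w => (1 + Z b w)%E)) //.
apply: (@le_trans _ _ (((2 * n.+1%:R)^-1)%:E * \sum_(b < n.+1) 2%:E)%E); last first.
  by rewrite sumEFin -EFinM lee_fin sumr_const card_ord -[2 *+ _]mulr_natr mulVf //.
apply: lee_wpmul2l; first by rewrite lee_fin.
apply: lee_sum => b _; rewrite ge0_integralD //.
rewrite integral_cst // mul1e.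
have -> : (2%:E = 1 + 1 :> \bar R)%E by rewrite -EFinD; congr EFin; ring.
apply: leeD; first exact: probability_le1.
by apply: iZ; rewrite -ltnS.
Qed.

(** * Weighted dyadic series and their expectation *)

Section DyadicSeries.
Context {R : realType} {d : measure_display} {T : measurableType d}.
Variables (P : probability T R) (u : nat -> nat -> T -> R).
Hypothesis u_ge0 : forall j k w, 0 <= u j k w.
Hypothesis u_meas : forall j k, (k < 2 ^ j)%N -> measurable_fun setT (u j k).
Hypothesis u_int : forall j k, (k < 2 ^ j)%N -> (\int[P]_w (u j k w)%:E <= 1)%E.

Definition dyadic_level (j : nat) (w : T) : R :=
  (2 ^+ (2 * j).+1)^-1 * \sum_(k < 2 ^ j) u j k w.

Definition dyadic_series (w : T) : \bar R :=
  (\sum_(0 <= j <oo) (dyadic_level j w)%:E)%E.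

Let weight_ge0 j : 0 <= (2 ^+ (2 * j).+1)^-1 :> R.
Proof. by rewrite invr_ge0 exprn_ge0. Qed.

Let level_ge0 j w : 0 <= dyadic_level j w.
Proof. by rewrite mulr_ge0 // sumr_ge0. Qed.

Let level_meas j : measurable_fun setT (fun w => (dyadic_level j w)%:E).
Proof.
apply/measurable_EFinP; apply: measurable_funM; first exact: measurable_cst.
apply: (@measurable_sum _ _ _ _ 'I_(2 ^ j) _ (fun k w => u j k w)) => k.
exact: u_meas.
Qed.

Lemma dyadic_series_ge0 w : (0 <= dyadic_series w)%E.
Proof. by apply: nneseries_ge0 => j _ _; rewrite lee_fin. Qed.

Lemma measurable_dyadic_series : measurable_fun setT dyadic_series.
Proof.
apply: (@ge0_emeasurable_sum _ _ _ _ (fun j w => (dyadic_level j w)%:E) xpredT).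
  by move=> j w _ _; rewrite lee_fin.
by move=> j _.
Qed.

(** Level [j] consists of [2 ^ j] variables of mean at most 1 with weight [2 ^ (-2j-1)], so it
    contributes at most [2 ^ (-j-1)], and these sum to 1. *)
Lemma integral_dyadic_series : (\int[P]_w dyadic_series w <= 1)%E.
Proof.
rewrite /dyadic_series integral_nneseries //; last first.
  by move=> j w _; rewrite lee_fin.
have lvl j : (\int[P]_w (dyadic_level j w)%:E <= (1 / (2 ^ (j + 1))%:R)%:E)%E.
  under eq_integral do rewrite /dyadic_level EFinM -sumEFin.
  have um (k : 'I_(2 ^ j)) : measurable_fun setT (fun w => (u j k w)%:E).
    by apply/measurable_EFinP; exact: u_meas.
  rewrite ge0_integralZl //; last first.
  - by move=> w _; apply: sume_ge0 => k _; rewrite lee_fin.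
  - exact: (@emeasurable_sum _ _ _ _ 'I_(2 ^ j) _ (fun k w => (u j k w)%:E)).
  rewrite (@ge0_integral_sum _ _ _ _ _ _ 'I_(2 ^ j) (fun k w => (u j k w)%:E)) //; last first.
    by move=> k w _; rewrite lee_fin.
  apply: (@le_trans _ _ (((2 ^+ (2 * j).+1)^-1)%:E * \sum_(k < 2 ^ j) 1)%E).
    apply: lee_wpmul2l; first by rewrite lee_fin.
    by apply: lee_sum => k _; exact: u_int.
  rewrite sumEFin -EFinM lee_fin sumr_const card_ord addn1 !natrX.
  have -> : 2 ^+ (2 * j).+1 = 2 * (2 ^+ j * 2 ^+ j) :> R.
    by rewrite exprS mul2n -addnn exprD.
  rewrite exprS le_eqVlt; apply/orP; left; apply/eqP.
  by field; rewrite expf_neq0.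
apply: (@le_trans _ _ (\sum_(0 <= j <oo) (1 / (2 ^ (j + 1))%:R)%:E)%E).
  apply: lee_nneseries => // j _ _.
  by apply: integral_ge0 => w _; rewrite lee_fin.
have := @cvg_geometric_eseries_half R 1 0; rewrite expr0 divr1 => /cvg_lim -> //.
Qed.

(** A single nonnegative term is at most the whole series. Finiteness matters because [fine] sends
    [+oo] to 0. *)
Lemma dyadic_series_term_le w j k : (k < 2 ^ j)%N -> (dyadic_series w < +oo)%E ->
  u j k w <= 2 ^+ (2 * j).+1 * fine (dyadic_series w).
Proof.
move=> kj fin.
have finZ : dyadic_series w \is a fin_num.
  by rewrite ge0_fin_numE // dyadic_series_ge0.
rewrite -ler_pdivrMl ?exprn_gt0 // -lee_fin fineK //.
apply: (@le_trans _ _ (dyadic_level j w)%:E).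
  rewrite lee_fin ler_wpM2l // (bigD1 (Ordinal kj)) //= lerDl.
  by rewrite sumr_ge0.
apply: le_trans (nneseries_lim_ge j.+1 _) => [|i _ _]; last by rewrite lee_fin.
rewrite big_nat_recr //= leeDr //.
by apply: sume_ge0 => i _; rewrite lee_fin.
Qed.

End DyadicSeries.

(** * From the pathwise bound to the bound with random variables of mean at most 1 *)

Theorem theorem1 (R : realType) (phi : R -> R) (q C Cphi Cphiq L : R)
  (hq0 : 0 < q) (hq1 : q < 1) (hC : 0 < C)
  (hphi_incr : forall x y, 0 <= x -> x < y -> phi x < phi y)
  (hphi0 : phi 0 = 0) (hphi1 : phi 1 = 1)
  (hCphi : 0 <= Cphi) (hphi_conv : convex_from phi Cphi)
  (hCphiq : 0 <= Cphiq) (hphiq_conv : convex_from (fun x => phi (x `^ q)) Cphiq)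
  (hL : forall x y, 0 <= x -> 0 <= y ->
          phi_inv phi (x * y) <= L * (phi_inv phi x + phi_inv phi y)) :
  exists K1 K2 : R,
  forall (d : measure_display) (T : measurableType d) (P : probability T R)
         (S : R) (X : T -> R -> R),
  0 < S ->
  (forall t, 0 <= t <= S -> measurable_fun setT (fun w => X w t)) ->
  (forall w, cadlag_on (X w) S) ->
  (forall s t, 0 <= s <= S -> 0 <= t <= S -> s != t ->
     (\int[P]_w (phi (`|X w s - X w t| / (C * `|s - t| `^ q)))%:E <= 1)%E) ->
  forall c : R, 0 < c ->
  exists Z1 Z2 : T -> R,
    [/\ measurable_fun setT Z1 /\ measurable_fun setT Z2,
        (forall w, 0 <= Z1 w) /\ (forall w, 0 <= Z2 w),
        (\int[P]_w (Z1 w)%:E <= 1)%E /\ (\int[P]_w (Z2 w)%:E <= 1)%E &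
        forall w, (TVc (X w) 0 S c <=
          (c `^ ((q - 1) / q) * S *
            (K1 * phi_inv phi (Z1 w + phi Cphi)
             + K2 * (phi_inv phi (Z2 w + phi (Cphiq `^ q))) `^ (1 / q)))%:E)%E].
Proof.
(* The rate [q / 4] is chosen so that growth over [2j] doublings exactly cancels
   [(2 ^ (-q/2)) ^ j]. *)
have r01 : 1 < 2 `^ (q / 4) by apply: powR_gt1; rewrite ?ltr1n // divr_gt0.
have [L0 [A1 A10 hA1]] := phi_inv_pow2_le hphi_incr hphi0 hCphi hphi_conv hphi1 r01 hL.
pose A := L * A1 * 2 `^ (q / 4).
have A0 : 0 <= A by rewrite !mulr_ge0 // powR_ge0.
have inv_pow2 j : L * phi_inv phi (2 ^+ (2 * j).+1) * (2 `^ (- (q / 2))) ^+ j <= A.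
  have rj0 : 0 <= (2 `^ (- (q / 2))) ^+ j :> R by rewrite exprn_ge0 // powR_ge0.
  apply: (@le_trans _ _ (L * (A1 * (2 `^ (q / 4)) ^+ (2 * j).+1) * (2 `^ (- (q / 2))) ^+ j)).
    by rewrite ler_wpM2r // ler_wpM2l.
  rewrite /A exprS exprM.
  set s := 2 `^ (q / 4); set r := 2 `^ (- (q / 2)).
  have -> : L * (A1 * (s * (s ^+ 2) ^+ j)) * r ^+ j = L * A1 * s * (s ^+ 2 * r) ^+ j.
    by rewrite (exprMn _ (s ^+ 2)); ring.
  rewrite -[s ^+ 2]powR_mulrn ?powR_ge0 // -powRrM /r powRN.
  have -> : q / 4 * 2%:R = q / 2 by field.
  by rewrite divff ?gt_eqF ?powR_gt0 // expr1n mulr1.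
have phim := phi_le hphi_incr.
have phip := phi_ge0 hphi_incr hphi0.
have le_inv := le_phi_inv hphi_incr hCphi hphi_conv.
have inv_ge0 := phi_inv_ge0 hphi_incr hphi0 hCphi hphi_conv.
(* The factor 2 places [y] below half the mean block weight, as [orlicz_mean_le] asks. *)
pose K := 2 * TV_const q C L A.
have K0 : 0 < K.
  by rewrite mulr_gt0 // /TV_const !ltr_pwDl // mulr_ge0 // powR_ge0.
exists 0, K => d T P S X S0 mX cX iX c c0.
pose n := Num.truncn (S / c `^ (1 / q)); pose h := S / n.+1%:R.
have n0 : 0 < n.+1%:R :> R by [].
have h0 : 0 < h by rewrite divr_gt0.
have SE : h * n.+1%:R = S by rewrite /h divfK // gt_eqF.
(* A measurable real variable that bounds the truncated variation on every path; [cadlag_TV_le]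
   makes the supremum finite. *)
pose W w := sups (grid_seq h n.+1 c (X w)) 0.
have Wub w : has_ubound (range (grid_seq h n.+1 c (X w))).
  have [V TV] := cadlag_TV_le S0 c0 (cX w); exists V => _ [i _ <-].
  by apply: grid_seq_le_real => //; rewrite SE.
have Wle w V : (forall i, grid_seq h n.+1 c (X w) i <= V) -> W w <= V.
  move=> hV; apply: ge_sup; first by exists (grid_seq h n.+1 c (X w) 0); exists 0%N.
  by move=> _ [i _ <-].
have WTV w : TV_le (X w) 0 S c (W w).
  rewrite -SE; apply: TV_le_of_grid_seq => //; first by rewrite SE.
  move=> i; apply: ub_le_sup; last by exists i.
  by have [V hV] := Wub w; exists V => _ [k _ <-]; apply: hV; exists k.
have W0 w : 0 <= W w.
  have := WTV w 0%N (fun _ => 0); rewrite big_ord0; apply => //; exact: ltW.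
have pt_itv b j k : (b <= n)%N -> (k <= 2 ^ j)%N -> 0 <= dyadic_pt h b j k <= S.
  move=> bn kj; have -> : dyadic_pt h b j k = dyadic_pt h 0 j (b * 2 ^ j + k).
    by rewrite /dyadic_pt natrD natrM natrX add0r mulrDl mulfK //.
  rewrite -SE; apply: dyadic_pt_itv => //.
  by apply: leq_trans (leq_add (leqnn _) kj) _; rewrite -mulSnr leq_mul2r ltnS bn orbT.
have mW : measurable_fun setT W.
  apply: measurable_fun_sups => [w _|i]; first exact: Wub.
  rewrite /grid_seq; case: (@unpickle (nat * seq nat)%type i) => [x|]; last exact: measurable_cst.
  case gp : (is_grid_partition n.+1 x); last exact: measurable_cst.
  have /andP[_ /allP xa] := gp.
  apply: measurable_sum => i'.
  have mpt k : (k < size x.2)%N -> measurable_fun setT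
      (fun w => X w (dyadic_pt h 0 x.1 (nth 0%N x.2 k))).
    by move=> kx; apply: mX; rewrite -SE; apply: dyadic_pt_itv => //; apply/xa/mem_nth.
  have i1 : (i'.+1 < size x.2)%N by rewrite -ltn_predRL.
  apply: measurable_maxr; last exact: measurable_cst.
  apply: measurable_funB; last exact: measurable_cst.
  apply: measurableT_comp => //.
  by apply: measurable_funB; apply: mpt => //; exact: ltnW.
set kap := c `^ ((q - 1) / q) * S.
have kap0 : 0 < kap by rewrite mulr_gt0 // powR_gt0.
pose y w := W w / kap / K.
have y0 w : 0 <= y w by rewrite !divr_ge0 // ltW.
(* Defining Z2 from W itself makes the bound hold for every w, including the null set
   where the dyadic series diverges; only E Z2 <= 1 is then at stake. *)
pose Z2 w := Num.max (phi (y w `^ q) - phi (Cphiq `^ q)) 0.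
(* Setting the variable to 0 outside the range, where points could leave [[0, S]], makes
   measurability and the moment bound hold for all indices. *)
pose u b j k w := if (b <= n)%N && (k < 2 ^ j)%N then
  phi (orlicz_ratio q C (X w) (dyadic_pt h b j k.+1) (dyadic_pt h b j k)) else 0.
have ratio_ge0 f s t : 0 <= orlicz_ratio q C f s t.
  by rewrite divr_ge0 // mulr_ge0 ?powR_ge0 // ltW.
have u0 b j k w : 0 <= u b j k w by rewrite /u; case: ifP => // _; exact: phip.
have mu b j k : measurable_fun setT (u b j k).
  rewrite /u; have [/andP[bn kj]|_] := boolP ((b <= n)%N && (k < 2 ^ j)%N); last exact: measurable_cst.
  apply: measurable_phi_comp => //.
  apply: measurable_funM; last exact: measurable_cst.
  apply: measurableT_comp => //.
  by apply: measurable_funB; apply: mX; apply: pt_itv => //; exact: ltnW.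
have iu b j k : (\int[P]_w (u b j k w)%:E <= 1)%E.
  rewrite /u; have [/andP[bn kj]|_] := boolP ((b <= n)%N && (k < 2 ^ j)%N); last by rewrite integral0.
  apply: iX; [exact: pt_itv|by apply: pt_itv => //; exact: ltnW|].
  by rewrite gt_eqF // /dyadic_pt ltr_pM2l // ltrD2l ltr_pM2r ?ltr_nat // invr_gt0 exprn_gt0.
have mZ2 : measurable_fun setT Z2.
  apply: measurable_maxr; last exact: measurable_cst.
  apply: measurable_funB; last exact: measurable_cst.
  apply: measurable_phi_comp => // [w|]; first exact: powR_ge0.
  apply: (measurableT_comp (measurable_powR q)).
  by apply: measurable_funM; last exact: measurable_cst; apply: measurable_funM.
have Z20 w : 0 <= Z2 w by rewrite le_max lexx orbT.
exists (fun _ => 0), Z2; split => //.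
- split=> //; first by rewrite integral0.
  apply: (@integral_le_of_mean _ _ _ _ (fun b => dyadic_series (u b)) _ n) => //.
  + by move=> b; apply: measurable_dyadic_series.
  + by move=> b w; apply: dyadic_series_ge0.
  + by move=> b _; apply: integral_dyadic_series.
  move=> w; have Zb0 b := dyadic_series_ge0 (u0 b) w.
  (* If every block series converges at [w], the pathwise bound applies; otherwise the right side is
     [+oo]. *)
  have [fin|inf] := pselect (forall b, (b <= n)%N -> (dyadic_series (u b) w < +oo)%E).
    pose z b := fine (dyadic_series (u b) w).
    have z0 b : 0 <= z b by exact: fine_ge0.
    have -> : (\sum_(b < n.+1) (1 + dyadic_series (u b) w))%E =
        (\sum_(b < n.+1) (1 + z b))%:E.
      rewrite -sumEFin; apply: eq_bigr => b _; rewrite EFinD fineK //.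
      by rewrite ge0_fin_numE // fin // -ltnS.
    rewrite -EFinM lee_fin ge_max; apply/andP; split; last first.
      by rewrite mulr_ge0 ?invr_ge0 ?mulr_ge0 // sumr_ge0 // => b _; rewrite addr_ge0.
    apply: (orlicz_mean_le hq0 hphi_incr hphi0 hphi1 hCphi hphi_conv hCphiq hphiq_conv) => //.
    rewrite /y ler_pdivrMr // ler_pdivrMr // /K.
    apply: Wle; apply: grid_seq_le => m.
    have hz b j k : (b <= n)%N -> (k < 2 ^ j)%N ->
        phi (orlicz_ratio q C (X w) (dyadic_pt h b j k.+1) (dyadic_pt h b j k))
          <= 2 ^+ (2 * j).+1 * z b.
      move=> bn kj; have := dyadic_series_term_le (u0 b) kj (fin b bn).
      by rewrite {1}/u bn kj.
    have := TV_le_grid (m := m) hq0 hq1 hC L0 A0 le_inv inv_ge0 hL inv_pow2 S0 c0 (erefl n) z0 hz.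
    rewrite -/kap; set a := (\sum_(b < n.+1) _) / n.+1%:R.
    by have -> : a / 2 * (2 * TV_const q C L A) * kap = kap * (TV_const q C L A * a) by field.
  suff -> : (\sum_(b < n.+1) (1 + dyadic_series (u b) w) = +oo)%E.
    by rewrite mulry gtr0_sg ?mul1e ?leey // invr_gt0 mulr_gt0.
  move/existsNP : inf => [b /not_implyP[bn /negP]]; rewrite -leNgt leye_eq => /eqP Zb.
  apply/esum_eqyP.
    by move=> i _; rewrite gt_eqF // (lt_le_trans _ (adde_ge0 _ _)) ?lte_fin.
  exists (Ordinal (bn : (b < n.+1)%N)).
  by split; [exact: mem_index_enum|by []|rewrite /= Zb].
move=> w; apply: le_trans (TVc_le (WTV w)) _; rewrite lee_fin mul0r add0r.
rewrite -ler_pdivrMl // [kap^-1 * _]mulrC -ler_pdivrMl // [K^-1 * _]mulrC -/(y w).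
(* By the choice of [Z2], [phi (y ^ q)] is at most [Z2 + phi (Cphiq ^ q)]; taking the power [1 / q]
   then recovers [y], the rescaled variation. *)
have yinv : y w `^ q <= phi_inv phi (Z2 w + phi (Cphiq `^ q)).
  by apply: le_inv; rewrite ?powR_ge0 // -lerBlDr le_max lexx.
have -> : y w = (y w `^ q) `^ (1 / q).
  by rewrite -powRrM; have -> : q * (1 / q) = 1 by [field; rewrite gt_eqF]; rewrite powRr1.
apply: ge0_ler_powR => //; rewrite ?nnegrE ?powR_ge0 ?divr_ge0 ?(ltW hq0) //.
exact: le_trans (powR_ge0 _ _) yinv.
Qed.
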